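(* Let $(X,A_X)$ be a dissimilarity network, and let $(X,A_X^\top)$ be its transpose, where $A_X^\top(x,x') := A_X(x',x)$ for all $x,x'\in X$. Then for each integer $k\ge 0$, the $k$-dimensional persistent path homologies $\mathcal{H}_k(X,A_X)$ and $\mathcal{H}_k(X,A_X^\top)$ are isomorphic (as persistent vector spaces).
   Context: Fix a field $\mathbb{K}$. For a finite set $S$, $\mathbb{K}[S]$ denotes the free $\mathbb{K}$-vector space on $S$. Write $\mathbb{Z}_+$, $\mathbb{R}_+$ for the nonnegative integers and reals. **Networks.** A (dissimilarity) network is a finite set $X$ with a weight function $A_X:X\times X\to\mathbb{R}_+$ such that $A_X(x,y)=0$ if and only if $x=y$. No symmetry or triangle inequality is assumed. **Regular paths.** For a finite set $X$ and $p\in\mathbb{Z}_+$, an elementary $p$-path is a sequence $[x_0,\dots,x_p]$ of elements of $X$; it is regular if $x_i\ne x_{i+1}$ for all $0\le i\le p-1$ and irregular otherwise. Let $\Lambda_p(X)$ be the free $\mathbb{K}$-vector space on all elementary $p$-paths, $\mathcal{I}_p(X)$ the subspace spanned by the irregular ones, and $\mathcal{R}_p(X)$ the subspace spanned by the regular ones. Set $\Lambda_{-1}:=\mathbb{K}$, $\Lambda_{-2}:=\{0\}$. The non-regular boundary map $\partial_p^{\mathrm{nr}}:\Lambda_p\to\Lambda_{p-1}$ is the linear map with $\partial_p^{\mathrm{nr}}[x_0,\dots,x_p]=\sum_{i=0}^p(-1)^i[x_0,\dots,\widehat{x_i},\dots,x_p]$ (for $p=0$, the empty path is identified with $1\in\mathbb{K}$),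 and $\partial_{-1}^{\mathrm{nr}}:=0$. One has $\partial_p^{\mathrm{nr}}(\mathcal{I}_p)\subseteq\mathcal{I}_{p-1}$, and the regular boundary map $\partial_p:\mathcal{R}_p\to\mathcal{R}_{p-1}$ is the map induced via the natural isomorphism $\mathcal{R}_p\cong\Lambda_p/\mathcal{I}_p$ (i.e. apply $\partial_p^{\mathrm{nr}}$ and replace irregular paths by $0$); in degree $-1$ the space is $\mathbb{K}$. **Path homology.** A digraph is a pair $G=(X,E)$ with $X$ finite and $E\subseteq X\times X$ containing no self-loops. An elementary $p$-path $[x_0,\dots,x_p]$ is allowed on $G$ if $(x_i,x_{i+1})\in E$ for all $0\le i\le p-1$. Let $\mathcal{A}_p(G)$ be the free $\mathbb{K}$-vector space on allowed $p$-paths, $\mathcal{A}_{-1}:=\mathbb{K}$, $\mathcal{A}_{-2}:=\{0\}$. The space of $\partial$-invariant $p$-paths is $\Omega_p(G):=\{c\in\mathcal{A}_p(G):\partial_p c\in\mathcal{A}_{p-1}(G)\}$ for $p\in\mathbb{Z}_+$, with $\Omega_{-1}:=\mathbb{K}$, $\Omega_{-2}:=\{0\}$. The maps $\partial_p$ restrict to a chain complex $\cdots\to\Omega_2\to\Omega_1\to\Omega_0\to\mathbb{K}\to 0$, and for $p\in\mathbb{Z}_+$, $H_p(G):=\ker(\partial_p|_{\Omega_p})/\operatorname{im}(\partial_{p+1}|_{\Omega_{p+1}})$. **Persistent path homology.** For a network $(X,A_X)$ and $\delta\in\mathbb{R}_+$, let $\mathfrak{G}_X^\delta=(X,E_X^\delta)$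 with $E_X^\delta:=\{(x,x')\in X\times X: x\ne x',\ A_X(x,x')\le\delta\}$. For $\delta\le\delta'$ the inclusion $\iota_{\delta,\delta'}:\mathfrak{G}_X^\delta\hookrightarrow\mathfrak{G}_X^{\delta'}$ (identity on vertices) induces the inclusion of chain complexes $\Omega_\bullet(\mathfrak{G}_X^\delta)\subseteq\Omega_\bullet(\mathfrak{G}_X^{\delta'})$ and hence linear maps $(\iota_{\delta,\delta'})_\#$ on homology. The $p$-dimensional persistent path homology is the family $\mathcal{H}_p(X,A_X):=\{H_p(\mathfrak{G}_X^\delta)\xrightarrow{(\iota_{\delta,\delta'})_\#}H_p(\mathfrak{G}_X^{\delta'})\}_{\delta\le\delta'\in\mathbb{R}_+}$. An isomorphism of persistent vector spaces $\{V^\delta,\nu_{\delta,\delta'}\}$ and $\{U^\delta,\mu_{\delta,\delta'}\}$ is a family of linear isomorphisms $V^\delta\to U^\delta$, one for each $\delta$, commuting with the maps $\nu_{\delta,\delta'}$ and $\mu_{\delta,\delta'}$ for all $\delta\le\delta'$. *)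

(* Defs.v *)
From HB Require Import structures.
From mathcomp Require Import all_boot all_order all_algebra.
From mathcomp Require Import generic_quotient ring_quotient interval_inference.
From mathcomp Require Import reals zify.

Set Implicit Arguments.
Unset Strict Implicit.
Unset Printing Implicit Defensive.
Import Order.TTheory GRing.Theory Num.Theory.
Local Open Scope ring_scope.
Local Open Scope quotient_scope.

(* The zmodType structure on Quotient.quot comes from ring_quotient; only the
   scaling is added here. *)
Section QuotientSpace.
Variables (K : fieldType) (V : vectType K) (W : {vspace V}).

Definition quotv : Type := Quotient.quot (W : zmodClosed V).

HB.instance Definition _ := GRing.Zmodule.on quotv.

Definition classv (v : V) : quotv := \pi_(Quotient.quot (W : zmodClosed V)) v.
Definition reprv (q : quotv) : V := repr q.

Lemma reprvK q : classv (reprv q) = q. Proof. exact: reprK. Qed.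

Lemma classv_eq u v : (classv u = classv v) <-> (u - v \in W).
Proof.
rewrite -[u - v \in W]/(u - v \in (W : zmodClosed V)).
by rewrite Quotient.idealrBE; split=> /eqP.
Qed.

Lemma classv_add u v : classv (u + v) = classv u + classv v.
Proof. by rewrite /classv (Quotient.pi_add (W : zmodClosed V)). Qed.

Definition scaleqv (a : K) (q : quotv) : quotv := classv (a *: reprv q).

Lemma classv_scale a v : classv (a *: v) = scaleqv a (classv v).
Proof.
by apply/classv_eq; rewrite -scalerBr memvZ //; apply/classv_eq; rewrite reprvK.
Qed.

Fact scaleqvA a b q : scaleqv a (scaleqv b q) = scaleqv (a * b) q.
Proof. by rewrite -[q]reprvK -!classv_scale scalerA. Qed.

Fact scaleqv1 : left_id 1 scaleqv.
Proof. by move=> q; rewrite -[q]reprvK -classv_scale scale1r. Qed.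

Fact scaleqvDr : right_distributive scaleqv +%R.
Proof.
move=> a p q; rewrite -[p]reprvK -[q]reprvK.
by rewrite -classv_add -!classv_scale scalerDr classv_add.
Qed.

Fact scaleqvDl q : {morph scaleqv^~ q : a b / a + b}.
Proof.
by move=> a b; rewrite -[q]reprvK -!classv_scale scalerDl classv_add.
Qed.

HB.instance Definition _ := GRing.Zmodule_isLmodule.Build K quotv
  scaleqvA scaleqv1 scaleqvDr scaleqvDl.

Fact classv_is_linear : linear classv.
Proof. by move=> a u v; rewrite classv_add classv_scale. Qed.

HB.instance Definition _ := GRing.isLinear.Build K V quotv _ classv
  classv_is_linear.

End QuotientSpace.

(* For B <= Z this is Z / B, the second subspace being B seen inside Z. *)
Definition subquot (K : fieldType) (V : vectType K) (Z B : {vspace V}) :=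
  quotv (linfun (@vsval K V Z) @^-1: B)%VS.

HB.instance Definition _ (K : fieldType) (V : vectType K) (Z B : {vspace V}) :=
  GRing.Lmodule.on (subquot Z B).

(* The map Z / B -> Z' / B' sending the class of z to the class of z; the
   inclusions only serve to make it linear. *)
Section SubquotMap.
Variables (K : fieldType) (V : vectType K) (Z B Z' B' : {vspace V}).
Hypotheses (sZ : (Z <= Z')%VS) (sB : (B <= B')%VS).

Definition subquot_class (z : subvs_of Z) : subquot Z B := classv _ z.

Definition subquot_map of (Z <= Z')%VS & (B <= B')%VS :=
  fun q : subquot Z B =>
    classv _ (vsproj Z' (vsval (reprv q))) : subquot Z' B'.

Lemma subquot_mapE (z : subvs_of Z) :
  subquot_map sZ sB (subquot_class z) = classv _ (vsproj Z' (vsval z)).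
Proof.
apply/classv_eq; rewrite -memv_preim lfunE linearB /=.
rewrite !vsprojK ?(subvP sZ) ?subvsP //; apply: (subvP sB).
rewrite -linearB -(lfunE (@vsval K V Z)) memv_preim.
by apply/classv_eq; rewrite reprvK.
Qed.

Fact subquot_map_is_linear : linear (subquot_map sZ sB).
Proof.
move=> a p q; rewrite -[p](@reprvK K) -[q](@reprvK K) -linearP.
rewrite !subquot_mapE /= -[RHS]linearP /=.
by rewrite -linearP /= linearP.
Qed.

HB.instance Definition _ := GRing.isLinear.Build K (subquot Z B)
  (subquot Z' B') _ (subquot_map sZ sB) subquot_map_is_linear.

End SubquotMap.

Lemma subquot_map_id (K : fieldType) (V : vectType K) (Z B : {vspace V})
    (sZ : (Z <= Z)%VS) (sB : (B <= B)%VS) q : subquot_map sZ sB q = q.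
Proof. by rewrite /subquot_map vsvalK reprvK. Qed.

Lemma subquot_map_comp (K : fieldType) (V : vectType K)
    (Z B Z' B' Z'' B'' : {vspace V})
    (sZ : (Z <= Z')%VS) (sB : (B <= B')%VS)
    (sZ' : (Z' <= Z'')%VS) (sB' : (B' <= B'')%VS)
    (sZ'' : (Z <= Z'')%VS) (sB'' : (B <= B'')%VS) q :
  subquot_map sZ' sB' (subquot_map sZ sB q) = subquot_map sZ'' sB'' q.
Proof.
apply: etrans (subquot_mapE sZ' sB' (vsproj Z' (vsval (reprv q)))) _.
by rewrite vsprojK // (subvP sZ) ?subvsP.
Qed.

(* K[S], with basis the indicator functions [basisv s]. *)
Definition freev (K : fieldType) (S : finType) := {ffun S -> K^o}.

HB.instance Definition _ K S := Vector.on (freev K S).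

Definition basisv (K : fieldType) (S : finType) (s : S) : freev K S :=
  [ffun t => (t == s)%:R].

Definition linext (K : fieldType) (S : finType) (V : lmodType K) (f : S -> V) :=
  fun c : freev K S => \sum_s c s *: f s.

Fact linext_is_linear (K : fieldType) (S : finType) (V : lmodType K)
  (f : S -> V) : linear (linext f).
Proof.
move=> a u v; rewrite /linext scaler_sumr -big_split /=.
by apply: eq_bigr => s _; rewrite !ffunE scalerDl scalerA.
Qed.

HB.instance Definition _ (K : fieldType) (S : finType) (V : lmodType K)
  (f : S -> V) := GRing.isLinear.Build K (freev K S) V _ (linext f)
  (linext_is_linear f).

Lemma linext_basisv (K : fieldType) (S : finType) (V : lmodType K)
  (f : S -> V) s : linext f (basisv K s) = f s.
Proof.
rewrite /linext (bigD1 s) //= big1 => [|t /negPf ts].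
  by rewrite !ffunE eqxx addr0 scale1r.
by rewrite !ffunE ts scale0r.
Qed.

Lemma linext_unique (K : fieldType) (S : finType) (V : lmodType K)
    (f : {linear freev K S -> V}) c : f c = linext (f \o basisv K (S := S)) c.
Proof.
have {1}-> : c = \sum_s (c s : K) *: basisv K s.
  apply/ffunP => t; rewrite sum_ffunE (bigD1 t) //= big1 => [|s /negPf st].
    by rewrite !ffunE eqxx addr0 /GRing.scale /= mulr1.
  by rewrite !ffunE eq_sym st scaler0.
by rewrite linear_sum; apply: eq_bigr => s _; rewrite linearZ.
Qed.

Lemma freev_ext (K : fieldType) (S : finType) (V : lmodType K)
    (f g : {linear freev K S -> V}) :
  (forall s, f (basisv K s) = g (basisv K s)) -> f =1 g.
Proof.
move=> fg c; rewrite !linext_unique.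
by apply: eq_bigr => s _; rewrite /= fg.
Qed.

(* Paths are indexed by their number of vertices: an elementary p-path is a
   p.+1.-tuple, so that Lambda K X n is the space of (n-1)-paths.  For n = 0
   the only tuple is the empty path, and Lambda K X 0 is K. *)
Section RegularPaths.
Variables (K : fieldType) (X : finType).

Definition Lambda (n : nat) := freev K (n.-tuple X).

HB.instance Definition _ n := Vector.on (Lambda n).

Definition epath n (s : n.-tuple X) : Lambda n := basisv K s.

Definition regular (s : seq X) : bool := sorted (fun x y => x != y) s.

Definition face n (i : 'I_n.+1) (s : n.+1.-tuple X) : n.-tuple X :=
  [tuple tnth s (lift i j) | j < n].

Definition boundary_nr n : Lambda n.+1 -> Lambda n :=
  linext (fun s : n.+1.-tuple X => \sum_(i < n.+1) (-1) ^+ i *: epath (face i s)).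

HB.instance Definition _ n := GRing.Linear.on (@boundary_nr n).

(* The projection onto the span of the regular paths along the span of the
   irregular ones. *)
Definition regular_part n : Lambda n -> Lambda n :=
  linext (fun s : n.-tuple X => if regular s then epath s else 0).

HB.instance Definition _ n := GRing.Linear.on (@regular_part n).

(* The regular boundary map, extended by 0 to the span of the irregular paths:
   see irregular_boundary and boundary_nr_regular_part. *)
Definition boundary n : 'Hom(Lambda n.+1, Lambda n) :=
  linfun (@regular_part n \o @boundary_nr n).

Lemma boundary_nr_path n (s : n.+1.-tuple X) :
  boundary_nr (epath s) = \sum_(i < n.+1) (-1) ^+ i *: epath (face i s).
Proof. exact: linext_basisv. Qed.

Lemma boundary_nr2 n (c : Lambda n.+2) : boundary_nr (boundary_nr c) = 0.
Proof.
apply: (freev_ext (f := @boundary_nr n \o @boundary_nr n.+1) (g := \0)) => s /=.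
rewrite -[basisv K s]/(epath s).
rewrite boundary_nr_path linear_sum /=.
under eq_bigr => i _ do
  rewrite linearZ /= boundary_nr_path scaler_sumr.
rewrite pair_big /= (bigID (fun p : 'I_n.+2 * 'I_n.+1 => (p.2 < p.1)%N)) /=.
rewrite [X in _ + X](reindex_onto
  (fun p : 'I_n.+2 * 'I_n.+1 => (inord p.2, inord p.1.-1))
  (fun p : 'I_n.+2 * 'I_n.+1 => (inord p.2.+1, inord p.1))) /=; last first.
  move=> [i j] /= ij; have [ltj lti] := (ltn_ord j, ltn_ord i); rewrite !inordK; [|lia..].
  by congr pair; apply/val_inj; rewrite /= inordK //; lia.
rewrite [X in _ + X](eq_bigl (fun p : 'I_n.+2 * 'I_n.+1 => (p.2 < p.1)%N)).
  rewrite -big_split big1 // => -[i j] /= ji.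
  have [ltj lti] := (ltn_ord j, ltn_ord i).
  rewrite !scalerA -!exprD !inordK; [|lia..].
  have -> : face (inord i.-1) (face (inord j) s) = face j (face i s).
    apply/eq_from_tnth => k; rewrite !tnth_mktuple; congr tnth.
    by apply/val_inj; rewrite /= /bump !inordK; lia.
  have -> : (i + j = (j + i.-1).+1)%N by lia.
  by rewrite exprS mulN1r scaleNr addNr.
move=> [i j] /=; have [ltj lti] := (ltn_ord j, ltn_ord i).
by rewrite xpair_eqE -!val_eqE /= !inordK; lia.
Qed.

Lemma regular_part_path n (s : n.-tuple X) :
  regular_part (epath s) = if regular s then epath s else 0.
Proof. exact: linext_basisv. Qed.

Lemma regularPn n (s : n.-tuple X) :
  reflect (exists2 i : nat, (i.+1 < n)%N &
             exists x, nth x s i = nth x s i.+1) (~~ regular s).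
Proof.
apply: (iffP idP) => [|[i ltin [x eqi]]]; last first.
  apply/negP => /(sortedP x)/(_ i); rewrite size_tuple => /(_ ltin).
  by rewrite eqi eqxx.
case: s => -[|x s] szs; rewrite /regular //= => /negP ns.
have [/existsP[i /eqP eqi]|/existsPn ne] := boolP
    [exists i : 'I_(size s), nth x (x :: s) i == nth x s i].
  by exists i; [rewrite -(eqP szs) /= ltnS | exists x].
by case: ns; apply/(pathP x) => i lti; apply: (ne (Ordinal lti)).
Qed.

Lemma irregular_boundary n (s : n.+1.-tuple X) : ~~ regular s ->
  regular_part (boundary_nr (epath s)) = 0.
Proof.
case/regularPn => i ltin [x eqi]; have ltin' := ltnW ltin.
have nth_face (k : 'I_n.+1) j : (j < n)%N ->
    nth x (face k s) j = nth x s (bump k j).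
  move=> ltjn; rewrite -[j in LHS]/(val (Ordinal ltjn)) -tnth_nth tnth_mktuple.
  by rewrite (tnth_nth x).
rewrite boundary_nr_path linear_sum (bigD1 (Ordinal ltin)) //=.
rewrite (bigD1 (Ordinal ltin')) /=; last by rewrite -val_eqE /=; lia.
have -> : face (Ordinal ltin) s = face (Ordinal ltin') s.
  apply/val_inj; apply: (@eq_from_nth _ x); rewrite ?size_tuple // => j ltjn.
  rewrite !nth_face // /bump /=; have [->|neji] := eqVneq j i.
    by rewrite leqnn ltnn.
  by congr (nth x s _); lia.
rewrite !linearZ /= exprS mulN1r scaleNr addrA addNr add0r big1 // => k.
rewrite -!val_eqE /= => /andP[ki ki1].
rewrite linearZ /= regular_part_path ifN ?scaler0 //.
have ltkn := ltn_ord k.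
apply/regularPn; exists (if k < i then i.-1 else i)%N.
  by case: ifP; lia.
exists x; rewrite !nth_face; [|case: ifP; lia..].
have -> : bump k (if (k < i)%N then i.-1 else i) = i by rewrite /bump; case: ifP; lia.
have -> : bump k (if (k < i)%N then i.-1 else i).+1 = i.+1.
  by rewrite /bump; case: ifP; lia.
exact: eqi.
Qed.

Lemma boundary_nr_regular_part n (c : Lambda n.+1) :
  regular_part (boundary_nr (regular_part c)) = regular_part (boundary_nr c).
Proof.
apply: (freev_ext
  (f := @regular_part n \o @boundary_nr n \o @regular_part n.+1)
  (g := @regular_part n \o @boundary_nr n)) => s /=.
rewrite -[basisv K s]/(epath s) regular_part_path; case: ifPn => // irr.
by rewrite !linear0 irregular_boundary.
Qed.

Lemma boundary2 n (c : Lambda n.+2) : boundary n (boundary n.+1 c) = 0.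
Proof.
by rewrite !lfunE /= boundary_nr_regular_part boundary_nr2 linear0.
Qed.

End RegularPaths.

Record digraph (X : finType) := Digraph {
  edge :> rel X;
  edge_irrefl : irreflexive edge
}.

Section PathHomology.
Variables (K : fieldType) (X : finType).
Implicit Types G : digraph X.

Definition allowed G (s : seq X) : bool := sorted G s.

Lemma allowed_regular G s : allowed G s -> regular s.
Proof.
apply: sub_sorted => x y; apply: contraTneq => ->.
by rewrite edge_irrefl.
Qed.

(* The index n is again the number of vertices. *)
Definition allowed_space G n : {vspace Lambda K X n} :=
  <<[seq epath K s | s in [pred s : n.-tuple X | allowed G s]]>>%VS.

Definition Omega G n : {vspace Lambda K X n} :=
  match n with
  | 0 => fullv
  | m.+1 => (allowed_space G m.+1 :&: boundary K X m @^-1: allowed_space G m)%VS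
  end.

Definition cycles G p : {vspace Lambda K X p.+1} :=
  (Omega G p.+1 :&: lker (boundary K X p))%VS.

Definition boundaries G p : {vspace Lambda K X p.+1} :=
  (boundary K X p.+1 @: Omega G p.+2)%VS.

Lemma boundary_Omega G n : (boundary K X n @: Omega G n.+1 <= Omega G n)%VS.
Proof.
case: n => [|n]; first exact: subvf.
apply/subvP => _ /memv_imgP[c /memv_capP[_ dc] ->].
by rewrite memv_cap memv_preim dc /= -memv_preim boundary2 mem0v.
Qed.

Lemma boundaries_cycles G p : (boundaries G p <= cycles G p)%VS.
Proof.
rewrite subv_cap boundary_Omega; apply/subvP => _ /memv_imgP[c _ ->].
by rewrite memv_ker boundary2.
Qed.

(* Here p is the dimension, not the number of vertices; boundaries G p is
   contained in cycles G p by boundaries_cycles. *)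
Definition homology G p := subquot (cycles G p) (boundaries G p).

HB.instance Definition _ G p := GRing.Lmodule.on (homology G p).

Section Inclusion.
Variables (G G' : digraph X).
Hypothesis sGG' : subrel G G'.

Lemma allowed_space_sub n : (allowed_space G n <= allowed_space G' n)%VS.
Proof.
apply: sub_span => c /imageP[s aGs ->]; apply: image_f.
exact: sub_sorted sGG' _ aGs.
Qed.

Lemma Omega_sub n : (Omega G n <= Omega G' n)%VS.
Proof.
case: n => [|n]; first exact: subvv.
apply/subvP => c /memv_capP[ac dc]; rewrite memv_cap.
rewrite (subvP (allowed_space_sub _)) //= -memv_preim.
by rewrite (subvP (allowed_space_sub _)) // memv_preim.
Qed.

Lemma cycles_sub p : (cycles G p <= cycles G' p)%VS.
Proof. exact: capvS (Omega_sub _) (subvv _). Qed.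

Lemma boundaries_sub p : (boundaries G p <= boundaries G' p)%VS.
Proof. exact: limgS (Omega_sub _). Qed.

Definition homology_map p : {linear homology G p -> homology G' p} :=
  subquot_map (cycles_sub p) (boundaries_sub p).

End Inclusion.
End PathHomology.

Record persistent_vspace (K : fieldType) (R : realType) := PersistentVspace {
  pv_space :> {nonneg R} -> lmodType K;
  pv_map : forall d d', d <= d' -> {linear pv_space d -> pv_space d'};
  pv_map_id : forall d (h : d <= d) v, pv_map h v = v;
  pv_map_comp : forall d d' d'' (h : d <= d') (h' : d' <= d'') (h'' : d <= d'')
    v, pv_map h' (pv_map h v) = pv_map h'' v
}.

Definition pv_isomorphic (K : fieldType) (R : realType)
    (V U : persistent_vspace K R) : Prop :=
  exists f : forall d, {linear V d -> U d},
    (forall d, bijective (f d)) /\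
    forall d d' (h : d <= d') v, f d' (pv_map V h v) = pv_map U h (f d v).

Record network (R : realType) := Network {
  carrier :> finType;
  weight : carrier -> carrier -> {nonneg R};
  weight_eq0 : forall x y, (weight x y)%:num = 0 <-> x = y
}.

Section Persistence.
Variables (K : fieldType) (R : realType) (N : network R).

Fact transpose_eq0 (x y : N) : (weight y x)%:num = 0 <-> x = y.
Proof. by rewrite weight_eq0; split. Qed.

Definition transpose_network : network R :=
  @Network R N (fun x y => weight y x) transpose_eq0.

Fact net_digraph_irrefl (d : {nonneg R}) :
  irreflexive (fun x y : N => (x != y) && (weight x y <= d)).
Proof. by move=> x; rewrite eqxx. Qed.

Definition net_digraph (d : {nonneg R}) : digraph N :=
  Digraph (net_digraph_irrefl d).

Fact net_digraph_sub d d' : d <= d' ->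
  subrel (net_digraph d) (net_digraph d').
Proof.
by move=> dd' x y /andP[xy wd]; apply/andP; split=> //; apply: le_trans dd'.
Qed.

Definition pph_map p d d' (h : d <= d') :=
  homology_map K (net_digraph_sub h) p.

Arguments pph_map p [d d'].

Fact pph_map_id p d (h : d <= d) v : pph_map p h v = v.
Proof. exact: subquot_map_id. Qed.

Fact pph_map_comp p d d' d'' (h : d <= d') (h' : d' <= d'') (h'' : d <= d'') v :
  pph_map p h' (pph_map p h v) = pph_map p h'' v.
Proof. exact: subquot_map_comp. Qed.

Definition PPH (p : nat) : persistent_vspace K R :=
  @PersistentVspace K R (fun d => homology K (net_digraph d) p) (pph_map p)
    (@pph_map_id p) (@pph_map_comp p).

End Persistence.

(* Main.v *)
(* Reversing vertex sequences sends allowed paths of a digraph to allowed paths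
   of the transposed digraph, and commutes with the boundary map up to a sign
   that depends only on the degree.  Subspaces absorb that sign, so reversal
   identifies cycles with cycles and boundaries with boundaries; it is an
   involution, and it is defined on paths without reference to the edges, hence
   it commutes with the maps induced by inclusions of digraphs. *)
From HB Require Import structures.
Require Import Defs.
From mathcomp Require Import all_boot all_order all_algebra reals.
From mathcomp Require Import zify.

Set Implicit Arguments.
Unset Strict Implicit.
Unset Printing Implicit Defensive.
Import GRing.Theory.
Local Open Scope ring_scope.

Section SubquotHom.
Variables (K : fieldType) (V V' : vectType K) (phi : 'Hom(V, V')).
Variables (Z B : {vspace V}) (Z' B' : {vspace V'}).
Hypotheses (sZ : (phi @: Z <= Z')%VS) (sB : (phi @: B <= B')%VS).

(* The inclusions only serve to make the map linear. *)
Definition subquot_hom of (phi @: Z <= Z')%VS & (phi @: B <= B')%VS :=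
  fun q : subquot Z B =>
    subquot_class B' (vsproj Z' (phi (vsval (reprv q)))).

(** Independence of the representative: two of them differ by an element of [B], which [phi] sends
    into [B']. *)
Lemma subquot_homE (z : subvs_of Z) :
  subquot_hom sZ sB (subquot_class B z) =
    subquot_class B' (vsproj Z' (phi (vsval z))).
Proof.
have phiZ (u : subvs_of Z) : phi (vsval u) \in Z'.
  by rewrite (subvP sZ) // memv_img // subvsP.
apply/classv_eq; rewrite -memv_preim lfunE linearB /= !vsprojK //.
rewrite -linearB (subvP sB) // memv_img //.
rewrite -linearB -(lfunE (@vsval K V Z)) memv_preim.
by apply/classv_eq; rewrite reprvK.
Qed.

Fact subquot_hom_is_linear : linear (subquot_hom sZ sB).
Proof.
move=> a p q; rewrite -[p](@reprvK K) -[q](@reprvK K) -linearP.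
rewrite !subquot_homE /= -[RHS]linearP /=.
by rewrite /subquot_class -linearP /= !linearP.
Qed.

HB.instance Definition _ := GRing.isLinear.Build K (subquot Z B)
  (subquot Z' B') _ (subquot_hom sZ sB) subquot_hom_is_linear.

End SubquotHom.

(** Only one composite is treated; exchanging [phi] and [psi] handles the other, so two uses give
    bijectivity. *)
Lemma subquot_homK (K : fieldType) (V V' : vectType K)
    (phi : 'Hom(V, V')) (psi : 'Hom(V', V))
    (Z B : {vspace V}) (Z' B' : {vspace V'})
    (sZ : (phi @: Z <= Z')%VS) (sB : (phi @: B <= B')%VS)
    (sZ' : (psi @: Z' <= Z)%VS) (sB' : (psi @: B' <= B)%VS) :
  cancel phi psi -> cancel (subquot_hom sZ sB) (subquot_hom sZ' sB').
Proof.
move=> phiK q; rewrite -[q](@reprvK K) [subquot_hom sZ sB _]subquot_homE.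
rewrite subquot_homE vsprojK ?phiK ?vsvalK //.
by rewrite (subvP sZ) // memv_img // subvsP.
Qed.

(** Naturality square: both routes take the class of [z] to that of [phi z], as enlarging the
    subspaces keeps the representative. This gives compatibility with the persistence maps. *)
Lemma subquot_hom_map (K : fieldType) (V V' : vectType K) (phi : 'Hom(V, V'))
    (Z1 B1 Z2 B2 : {vspace V}) (Z1' B1' Z2' B2' : {vspace V'})
    (sZ : (Z1 <= Z2)%VS) (sB : (B1 <= B2)%VS)
    (sZ' : (Z1' <= Z2')%VS) (sB' : (B1' <= B2')%VS)
    (h1 : (phi @: Z1 <= Z1')%VS) (k1 : (phi @: B1 <= B1')%VS)
    (h2 : (phi @: Z2 <= Z2')%VS) (k2 : (phi @: B2 <= B2')%VS) q :
  subquot_hom h2 k2 (subquot_map sZ sB q) =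
    subquot_map sZ' sB' (subquot_hom h1 k1 q).
Proof.
rewrite -[q](@reprvK K) [subquot_map sZ sB _]subquot_mapE.
rewrite [subquot_hom h1 k1 _]subquot_homE subquot_mapE subquot_homE !vsprojK //.
  by rewrite (subvP h1) // memv_img // subvsP.
by rewrite (subvP sZ) // subvsP.
Qed.

Section Reversal.
Variables (K : fieldType) (X : finType).

Definition reversal n : 'End(Lambda K X n) :=
  linfun (linext (fun s : n.-tuple X => epath K (rev_tuple s))).

Lemma reversal_path n (s : n.-tuple X) :
  reversal n (epath K s) = epath K (rev_tuple s).
Proof. by rewrite lfunE /= linext_basisv. Qed.

Lemma reversalK n : involutive (reversal n).
Proof.
apply: (freev_ext (f := reversal n \o reversal n) (g := idfun)) => s /=.
rewrite -[basisv K s]/(epath K s) !reversal_path; congr epath.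
by apply/val_inj; rewrite /= revK.
Qed.

Lemma face_rev n (i : 'I_n.+1) (s : n.+1.-tuple X) :
  face i (rev_tuple s) = rev_tuple (face (rev_ord i) s).
Proof.
(* Only a default value for [nth]; it exists because [s] is nonempty. *)
have x := tnth s ord0.
have ltin := ltn_ord i.
apply/val_inj; apply: (@eq_from_nth _ x); rewrite ?size_tuple // => j ltjn.
have nth_face (k : 'I_n.+1) t l : (l < n)%N ->
    nth x (face k t) l = nth x t (bump k l).
  move=> ltln; rewrite -[l in LHS]/(val (Ordinal ltln)) -tnth_nth tnth_mktuple.
  by rewrite (tnth_nth x).
(* Both sides read [s] at position [n - bump i j], which equals [bump (n - i) (n - j.+1)]. *)
rewrite nth_face // nth_rev; last by rewrite size_tuple /bump; lia.
rewrite [in RHS]nth_rev ?size_tuple // nth_face; last by lia.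
by congr (nth x s _); rewrite /= /bump; lia.
Qed.

Lemma regular_rev (s : seq X) : regular (rev s) = regular s.
Proof.
rewrite /regular rev_sorted; apply: eq_sorted => x y.
by rewrite eq_sym.
Qed.

Lemma boundary_path n (s : n.+1.-tuple X) :
  boundary K X n (epath K s) = \sum_(i < n.+1)
    (-1) ^+ i *: (if regular (face i s) then epath K (face i s) else 0).
Proof.
rewrite lfunE /= boundary_nr_path (linear_sum (@regular_part K X n)).
by apply: eq_bigr => i _; rewrite linearZ /= regular_part_path.
Qed.

(** Face [i] of a path is paired with face [n - i] of its reverse, and one is regular exactly when
    the other is. The sign comes from [n - i] and [n + i] having the same parity. *)
Lemma boundary_reversal n (c : Lambda K X n.+1) :
  boundary K X n (reversal n.+1 c) =
    (-1) ^+ n *: reversal n (boundary K X n c).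
Proof.
apply: (freev_ext (f := boundary K X n \o reversal n.+1)
  (g := (-1) ^+ n \*: (reversal n \o boundary K X n))) => s /=.
rewrite -[basisv K s]/(epath K s) reversal_path !boundary_path.
rewrite linear_sum scaler_sumr (reindex_inj rev_ord_inj).
apply: eq_bigr => i _; rewrite face_rev rev_ordK regular_rev.
case: (regular _); last by rewrite !(scaler0, linear0).
rewrite linearZ /= reversal_path scalerA -exprD -signr_odd.
rewrite -[in RHS]signr_odd; congr ((-1) ^+ nat_of_bool _ *: _) => /=.
by have := ltn_ord i; lia.
Qed.

End Reversal.

Section Transpose.
Variables (K : fieldType) (X : finType) (G G' : digraph X).
Hypothesis GG' : forall x y, G' x y = G y x.

Lemma allowed_rev s : allowed G' (rev s) = allowed G s.
Proof. by rewrite /allowed rev_sorted; apply: eq_sorted => x y; rewrite GG'. Qed.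

Lemma reversal_allowed n :
  (reversal K X n @: allowed_space K G n <= allowed_space K G' n)%VS.
Proof.
rewrite limg_span; apply/span_subvP => _ /mapP[_ /imageP[s aGs ->] ->].
by rewrite reversal_path memv_span // image_f // inE allowed_rev.
Qed.

Lemma reversal_Omega n : (reversal K X n @: Omega K G n <= Omega K G' n)%VS.
Proof.
case: n => [|n]; first exact: subvf.
apply/subvP => _ /memv_imgP[c /memv_capP[ac dc] ->].
rewrite memv_cap (subvP (reversal_allowed _)) ?memv_img //= -memv_preim.
(* The sign is a scalar, so membership in the allowed space is unaffected. *)
rewrite boundary_reversal memvZ // (subvP (reversal_allowed _)) // memv_img //.
by rewrite memv_preim.
Qed.

Lemma reversal_cycles p :
  (reversal K X p.+1 @: cycles K G p <= cycles K G' p)%VS.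
Proof.
apply/subvP => _ /memv_imgP[c /memv_capP[oc dc] ->].
rewrite memv_cap (subvP (reversal_Omega _)) ?memv_img //=.
by move: dc; rewrite !memv_ker boundary_reversal => /eqP->; rewrite !linear0.
Qed.

Lemma reversal_boundaries p :
  (reversal K X p.+1 @: boundaries K G p <= boundaries K G' p)%VS.
Proof.
apply/subvP => _ /memv_imgP[_ /memv_imgP[c oc ->] ->].
(* The sign is inserted twice: one copy turns the reversed boundary into the boundary of a reversed
   chain, the other is absorbed by the subspace. *)
rewrite -[reversal _ _ _ _](signrZK p.+1) -boundary_reversal memvZ //.
by rewrite memv_img // (subvP (reversal_Omega _)) ?memv_img.
Qed.

Definition homology_reversal p : {linear homology K G p -> homology K G' p} :=
  subquot_hom (reversal_cycles p) (reversal_boundaries p).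

End Transpose.

Theorem theorem1 (K : fieldType) (R : realType) (N : network R) (k : nat) :
  pv_isomorphic (PPH K N k) (PPH K (transpose_network N) k).
Proof.
have tr d x y :
    net_digraph (transpose_network N) d x y = net_digraph N d y x.
  by rewrite /= eq_sym.
(* The same relation with the two networks exchanged, needed to build the inverse maps. *)
have tr' d x y :
    net_digraph N d x y = net_digraph (transpose_network N) d y x.
  by rewrite tr.
exists (fun d => homology_reversal K (tr d) k); split=> [d|d d' h v].
  by exists (homology_reversal K (tr' d) k); apply: subquot_homK;
    apply: reversalK.
exact: subquot_hom_map.
Qed.
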